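(* Let $X$ be a space such that Player $\beta$ has no winning strategy $\tau$ in the $\mathcal{J}_p(X)$-game whose first move $\tau(X)$ is non-meager. Let $Y$ be a space such that $Y\times Y$ is countably compact and let $Z$ be a pseudo-metric space. If $f\colon X\times Y\to Z$ is a separately continuous mapping, then there exists a residual set $R\subseteq X$ such that $f$ is jointly continuous at each point of $R\times Y$. Consequently, if $X$ is an open subspace of a $\Pi$-pseudo-metric space, $Y$ is a space such that $Y\times Y$ is countably compact, $Z$ is a pseudo-metric space, and $f\colon X\times Y\to Z$ is a separately continuous mapping, then there is a residual set $R\subseteq X$ such that $f$ is jointly continuous at each point of $R\times Y$.
   Context: No separation axioms are assumed. $\mathscr{O}(X)$ is the family of non-void open subsets of $X$. A $\mathcal{J}_p(X)$-play is a sequence $\{(B_i;A_i,a_i)\}_{i=1}^\infty$ in $\mathscr{O}(X)\times\mathscr{O}(X)\times X$ with $B_i\supseteq A_i\supseteq B_{i+1}$ for all $i$; Player $\beta$ moves first and picks the $B_i$, Player $\alpha$ picks the $(A_i,a_i)$, alternately (the points $a_i\in X$ are otherwise arbitrary). Player $\alpha$ wins the play if $\overline{\{a_i : i\in\mathbb{N}\}}\cap\bigcap_{i=1}^\infty A_i\neq\emptyset$; otherwise Player $\beta$ wins. A strategy $\tau$ for Player $\beta$ consists of a first move $\tau(X)\in\mathscr{O}(X)$ and of moves $\tau(X;A_1,a_1;\dots;A_n,a_n)\in\mathscr{O}(A_n)$ depending on the previous moves of Player $\alpha$; it is winning if Player $\beta$ wins every play consistent with it. A subset of a space is meager if it is a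 countable union of sets whose closures have empty interior, non-meager otherwise, and residual if its complement is meager. A space is countably compact if every countable open cover has a finite subcover. A $\Pi$-pseudo-metric space is a space homeomorphic to the product of a family of pseudo-metric spaces. A map of two variables is separately continuous if it is continuous in each variable when the other is fixed. *)

(* Defs.v *)
From HB Require Import structures.
From mathcomp Require Import all_boot all_order all_algebra finmap.
From mathcomp Require Import all_classical reals topology.

Set Implicit Arguments.
Unset Strict Implicit.
Unset Printing Implicit Defensive.

Local Open Scope classical_set_scope.

Section Category.
Context {X : topologicalType}.
Implicit Types A : set X.

Definition nowhere_dense A := (closure A)° = set0.

Definition meager A :=
  exists2 F : nat -> set X, (forall n, nowhere_dense (F n)) & A = \bigcup_n F n.

Definition residual A := meager (~` A).

(* Restriction of the library's [cover_compact] to countable covers. *)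
Definition countably_compact A := forall F : nat -> set X,
  (forall n, open (F n)) -> A `<=` cover setT F -> finite_subset_cover setT F A.

End Category.

Section Game.
Context {X : topologicalType}.
Implicit Types (B A : nat -> set X) (a : nat -> X) (tau : seq (set X * X) -> set X).

Definition nonvoid_open (U : set X) := open U /\ U !=set0.

Definition Jp_play B A a := forall i,
  [/\ nonvoid_open (B i), nonvoid_open (A i), A i `<=` B i & B i.+1 `<=` A i].

Definition alpha_wins A a := closure (range a) `&` \bigcap_i A i !=set0.

(* The first [n] moves of Player alpha. *)
Definition alpha_moves A a n : seq (set X * X) :=
  mkseq (fun k => (A k, a k)) n.

(* [tau [::]] is the first move.  Only legal histories matter: the value of
   [tau] on other sequences is irrelevant, since no play consistent with [tau]
   reaches them. *)
Definition beta_strategy tau :=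
  nonvoid_open (tau [::]) /\
  forall A a n,
    (forall k, (k <= n)%N ->
       nonvoid_open (A k) /\ A k `<=` tau (alpha_moves A a k)) ->
    nonvoid_open (tau (alpha_moves A a n.+1)) /\
    tau (alpha_moves A a n.+1) `<=` A n.

Definition consistent tau B A a := forall i, B i = tau (alpha_moves A a i).

Definition beta_winning tau := beta_strategy tau /\
  forall B A a, Jp_play B A a -> consistent tau B A a -> ~ alpha_wins A a.

End Game.

Definition homeomorphic (S T : topologicalType) :=
  exists (f : S -> T) (g : T -> S),
    [/\ continuous f, continuous g, cancel f g & cancel g f].

Definition Pi_pseudo_metric (R : realType) (W : topologicalType) :=
  exists (I : Type) (T : I -> pseudoMetricType R),
    homeomorphic W (prod_topology (fun i => T i : topologicalType)).

Definition separately_continuous (X Y Z : topologicalType) (f : X * Y -> Z) :=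
  (forall y, continuous (fun x => f (x, y))) /\
  (forall x, continuous (fun y => f (x, y))).

(* Main.v *)
Require Import Defs.
From HB Require Import structures.
From mathcomp Require Import all_boot all_order all_algebra finmap.
From mathcomp Require Import all_classical reals topology.
From mathcomp Require Import lra.
Import Order.TTheory GRing.Theory Num.Theory.

Local Open Scope classical_set_scope.

(** Call a set [V] of points of [X] [e]-small when [f (x, y)] moves by less
than [e], for all [y] at once, while [x] runs through [V].  A point [x] with an
[e]-small neighbourhood for every [e] is a point of joint continuity of [f] at
every [(x, y)] ([unif_close_continuous]), so it is enough that, for each [e],
the closed set of points without [e]-small neighbourhood is meager.

If it is not, its interior [B1] is non-meager and contains no [e]-small open
set.  Player beta can then win from [B1].  Since the image of [Y] under
finitely many functions [f (a, _)] is totally bounded, no finite set of points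
[a] controls [f] on an open subset of [B1]: beta can always answer by an open
set all of whose points [x] separate two points [y_n], [z_n] of [Y] that the
previous [a_i] hardly distinguish ([separating_pair]).  If [(p, q)] is a cluster
point of the pairs [(y_n, z_n)], which exists because [Y * Y] is countably
compact, no [a_i] distinguishes [p] from [q] at all, hence neither does a point
[x] in the closure of the [a_i]; but if [x] belonged to all the open sets
played, it would separate [p] from [q] ([sep_strategy_winning]).

For the second part, let [X] be embedded as an open set in a product of
pseudo-metric spaces and let beta follow a strategy whose first move is not
meager.  Fix a base point [b].  Player alpha answers with small cylinders
depending on finite sets [E_n] of coordinates that increase with [n], and with
points [a_n] that agree with [b] outside [E_n].  By Oxtoby's argument
([nonmeager_branch]), alpha can do so in such a way that the open sets played
have a common point [x]: otherwise the first move would be meager.  Changing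
[x] to [b] at the coordinates outside all the [E_n] yields a point that is
still in every cylinder, and to which the [a_n] converge ([alpha_beats]).  So
beta has no winning strategy with a non-meager first move, and the first part
applies. *)

(** * Meager sets *)

Section Category.
Context {X : topologicalType}.
Implicit Types A B U V W F : set X.

Lemma nonvoid_openI U V : open U -> open V -> U `&` V !=set0 ->
  nonvoid_open (U `&` V).
Proof. by move=> oU oV; split => //; exact: openI. Qed.

Lemma nowhere_dense_avoid A :
  (forall V, nonvoid_open V ->
     exists W, [/\ nonvoid_open W, W `<=` V & W `&` A = set0]) ->
  nowhere_dense A.
Proof.
move=> avoid; apply: contrapT => /eqP/set0P ne.
have [W [[oW [w Ww]] sWc WA0]] := avoid _ (conj (open_interior _) ne).
have /(_ W) := interior_subset (sWc _ Ww).
by rewrite setIC WA0 => /(_ (open_nbhs_nbhs (conj oW Ww)))[].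
Qed.

Lemma nowhere_dense0 : nowhere_dense (set0 : set X).
Proof. by rewrite /nowhere_dense closure0 interior0. Qed.

Lemma meager_nowhere_dense A : nowhere_dense A -> meager A.
Proof. by move=> ndA; exists (fun=> A) => //; rewrite bigcup_const. Qed.

Lemma meager_sub A B : A `<=` B -> meager B -> meager A.
Proof.
move=> sAB [F ndF BE]; exists (fun n => F n `&` A); last first.
  by rewrite -setI_bigcupl -BE; apply/esym/setIidr.
move=> n; rewrite /nowhere_dense -subset0 -(ndF n).
by apply: interiorS; apply: closure_subset; exact: subIsetl.
Qed.

Lemma meager_bigcup (F : nat -> set X) :
  (forall n, meager (F n)) -> meager (\bigcup_n F n).
Proof.
move=> mF.
have /choice[G GP] n : exists G : nat -> set X,
    (forall k, nowhere_dense (G k)) /\ F n = \bigcup_k G k.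
  by have [G ? ?] := mF n; exists G.
exists (fun k => if @choice.unpickle (nat * nat)%type k is Some p
                 then G p.1 p.2 else set0).
  move=> k; case: choice.unpickle => [[n m]|]; first exact: (GP n).1.
  exact: nowhere_dense0.
apply/seteqP; split=> [x [n _]|x [k _]].
  rewrite (GP n).2 => -[m _ Gx]; exists (choice.pickle (n, m)) => //.
  by rewrite choice.pickleK.
case: choice.unpickle => // -[n m] Gx; exists n => //.
by rewrite (GP n).2; exists m.
Qed.

Lemma meagerU A B : meager A -> meager B -> meager (A `|` B).
Proof.
move=> mA mB; rewrite -bigcup2E; apply: meager_bigcup => -[|[|n]] //=.
exact: meager_nowhere_dense nowhere_dense0.
Qed.

(** The boundary of a closed set is nowhere dense. *)
Lemma meager_closed F : closed F -> meager F° -> meager F.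
Proof.
move=> cF mF; rewrite -(setDUK (@interior_subset _ F)).
apply: meagerU => //; apply: meager_nowhere_dense.
apply: nowhere_dense_avoid => V [oV neV].
have [VF|nVF] := pselect (V `<=` F).
  exists V; split => //; rewrite -subset0 => x [Vx [_]]; apply.
  by move: VF; rewrite open_subsetE//; exact.
exists (V `&` ~` F); split.
- apply: nonvoid_openI => //; first exact: closed_openC.
  by apply: contrapT => /nonemptyPn/disjoints_subset; rewrite setCK.
- exact: subIsetl.
- by rewrite -subset0 => x [[_ nF] [/nF]].
Qed.

Lemma nowhere_dense_setD U D : open U -> open D ->
  (forall V, nonvoid_open V -> V `<=` U -> V `&` D !=set0) ->
  nowhere_dense (U `\` D).
Proof.
move=> oU oD dense; apply: nowhere_dense_avoid => V [oV neV].
have [VU|/nonemptyPn VU0] := pselect (V `&` U !=set0); last first.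
  exists V; split => //; rewrite -subset0 => x [Vx [Ux _]].
  by rewrite -VU0.
have nVU := dense _ (nonvoid_openI _ _ oV oU VU) (@subIsetr _ _ _).
exists (V `&` U `&` D); split.
- by apply: nonvoid_openI => //; exact: openI.
- by move=> x [[]].
- by rewrite -subset0 => x [[_ Dx] [_ /(_ Dx)]].
Qed.

End Category.

(** * Oxtoby's argument *)

Section Oxtoby.
Context {X : topologicalType} {S : Type} (O : S -> set X).
Variables (next : S -> S -> Prop) (ok : S -> Prop) (s0 : S).
Hypothesis ok0 : ok s0.
Hypothesis open_ok : forall s, ok s -> open (O s).
Hypothesis ok_next : forall s t, ok s -> next s t -> ok t /\ O t `<=` O s.
Hypothesis next_ex : forall s V, ok s -> nonvoid_open V -> V `<=` O s ->
  exists t, [/\ next s t, O t `<=` V & O t !=set0].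

(* Disjointness of the children is what makes the branch through a given point
   unique; their maximality makes them fill a dense part of [O s]. *)
Let child s : set S := sval (ex_maximal_disjoint_subcollection O
  [set t | next s t /\ O t !=set0]).

Let childP s : maximal_disjoint_subcollection O (child s)
  [set t | next s t /\ O t !=set0].
Proof. by rewrite /child; case: ex_maximal_disjoint_subcollection. Qed.

Let dense_child s V : ok s -> nonvoid_open V -> V `<=` O s ->
  exists2 t, child s t & V `&` O t !=set0.
Proof.
move=> oks noV sV; have [t [st stV [x Ox]]] := next_ex _ _ oks noV sV.
have [sub triv mx] := childP s.
have [ct|nct] := pselect (child s t).
  by exists t => //; exists x; split => //; exact: stV.
apply: contrapT => /forall2NP nV; apply: (mx (child s `|` [set t])).
- split=> [y|]; [by left | by move=> /(_ t (or_intror erefl))].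
- by move=> y [/sub//|->]; split => //; exists x.
- have far u : child s u -> O u `&` O t !=set0 -> False.
    move=> cu [y [Ouy Oty]]; have [//|] := nV u; apply.
    by exists y; split => //; exact: stV.
  move=> u v [cu|->] [cv|->] //; first exact: triv.
    by move=> /(far _ cu).
  by rewrite setIC => /(far _ cv).
Qed.

Fixpoint level n : set S :=
  if n is m.+1 then \bigcup_(s in level m) child s else [set s0].

Let level_ok n s : level n s -> ok s.
Proof.
elim: n s => [s ->//|n IH s [r /IH okr]].
have [sub _ _] := childP r; move=> /sub[nrs _].
by have [] := ok_next _ _ okr nrs.
Qed.

Let level_dense n V : nonvoid_open V -> V `<=` O s0 ->
  V `&` \bigcup_(s in level n) O s !=set0.
Proof.
elim: n => [|n IH] [oV neV] sV.
  by have [x Vx] := neV; exists x; split => //; exists s0 => //; exact: sV.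
have [x [Vx [s ls Os]]] := IH (conj oV neV) sV.
have oks := level_ok _ _ ls.
have VO : nonvoid_open (V `&` O s).
  by apply: nonvoid_openI => //; [exact: open_ok|exists x].
have [t ct [y [[Vy _] Oty]]] := dense_child _ _ oks VO (@subIsetr _ _ _).
by exists y; split => //; exists t => //; exists s.
Qed.

Let level_uniq n x s t : level n s -> level n t -> O s x -> O t x -> s = t.
Proof.
elim: n s t => [s t -> -> //|n IH s t [p lp cs] [q lq ct] Osx Otx].
have up r u : level n r -> child r u -> O u x -> O r x.
  move=> lr; have [sub _ _] := childP r; move=> /sub[nru _].
  by have [_] := ok_next _ _ (level_ok _ _ lr) nru; exact.
have pq : p = q by apply: IH => //; [exact: up cs _|exact: up ct _].
rewrite -pq in ct; have [_ triv _] := childP p.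
by apply: triv => //; exists x.
Qed.

(** Outside a meager set, every point of [O s0] belongs to some [O s] at each
level of the tree of children.  At each level this [s] is unique, so the states
found at successive levels are linked by [next]. *)
Lemma nonmeager_branch : ~ meager (O s0) ->
  exists (s : nat -> S) x,
    [/\ s 0%N = s0, forall n, next (s n) (s n.+1) & forall n, O (s n) x].
Proof.
move=> nm.
have [x [Ox xD]] : exists x, O s0 x /\ forall n, exists s, level n s /\ O s x.
  apply: contrapT => nx; apply: nm.
  have mD : meager (\bigcup_n (O s0 `\` \bigcup_(s in level n) O s)).
    apply: meager_bigcup => n; apply: meager_nowhere_dense.
    apply: nowhere_dense_setD; first exact: open_ok.
      by apply: bigcup_open => s /level_ok; exact: open_ok.
    by move=> V; exact: level_dense.
  apply: meager_sub mD => x Ox; apply: contrapT => ncov; apply: nx.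
  exists x; split => // n; apply: contrapT => nn; apply: ncov.
  by exists n => //; split => // -[s ls Os]; apply: nn; exists s.
have [s sP] := choice xD.
exists s, x; split; first by have [] := sP 0%N.
  move=> n; have [[r lr cs] Os] := sP n.+1; have [ln On] := sP n.
  have [sub _ _] := childP r; have [nrs _] := sub _ cs.
  suff <- : r = s n by [].
  apply: (level_uniq n x) => //.
  by have [_] := ok_next _ _ (level_ok _ _ lr) nrs; exact.
by move=> n; have [] := sP n.
Qed.

End Oxtoby.

(** * Neighbourhoods and countable compactness *)

Lemma near_finite {I T : Type} {F : set_system T} {FF : Filter F}
    (E : set I) (Q : I -> T -> Prop) :
  finite_set E -> (forall i, E i -> \forall t \near F, Q i t) ->
  \forall t \near F, forall i, E i -> Q i t.
Proof.
move=> /(@finite_fsetP {classic I})[D ->] DQ.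
have := @filter_bigI _ {classic I} D Q F FF DQ.
by apply: filterS => t Dt i /Dt.
Qed.

Lemma nbhs_prod {U V : topologicalType} {u : U} {v : V} {A B} :
  nbhs u A -> nbhs v B -> nbhs (u, v) (A `*` B).
Proof. by move=> uA vB; exists (A, B). Qed.

Lemma countably_compact_cluster (Y : topologicalType) (u : nat -> Y) :
  countably_compact [set: Y] -> exists p : Y, forall N, nbhs p N ->
  forall n, exists2 k, (n <= k)%N & N (u k).
Proof.
move=> ccY; pose tail n := [set u k | k in [set k | (n <= k)%N]].
pose U n := ~` closure (tail n).
have [covered|] := pselect ([set: Y] `<=` cover setT U).
  have oU n : open (U n) by exact: closed_openC (@closed_closure _ (tail n)).
  have [D _ Dcov] := ccY U oU covered.
  have [i /= iD] := Dcov (u (\max_(i <- D) i)%N) I.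
  case; apply: subset_closure; exists (\max_(i <- D) i)%N => //=.
  exact: (@leq_bigmax_seq _ _ xpredT id i iD).
rewrite /subset => /existsNP[p /not_implyP[_ np]]; exists p => N pN n.
have [] : (tail n `&` N) !=set0.
  apply: contrapT => nclos; apply: np; exists n => // /(_ _ pN).
  exact: nclos.
by move=> _ [[k /= nk <-] Nk]; exists k.
Qed.

(** Total boundedness, for two relations in the role of the distances [d / 2]
and [d].  Without a finite net, a greedy choice gives a sequence [u] without two
terms related by [close]; two of them are near a cluster point, which is a
contradiction. *)
Lemma countably_compact_finite_net (Y : topologicalType)
    (half_close close : Y -> Y -> Prop) :
  countably_compact [set: Y * Y] ->
  (forall p, nbhs p (half_close p)) ->
  (forall p y z, half_close p y -> half_close p z -> close y z) ->
  exists s : seq Y, forall y, exists2 z, z \in s & close z y.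
Proof.
move=> ccY nbhs_near nearP; apply: contrapT => nonet.
have /choice[c cP] (s : seq Y) : exists y, forall z, z \in s -> ~ close z y.
  apply: contrapT => ns; apply: nonet; exists s => y; apply: contrapT => ny.
  by apply: ns; exists y => z zs fzy; apply: ny; exists z.
pose L n := iter n (fun s => c s :: s) [::]; pose u n := c (L n).
have uL j k : (j < k)%N -> u j \in L k.
  elim: k => // k IH; rewrite ltnS leq_eqVlt => /predU1P[->|/IH jk].
    by rewrite /= mem_head.
  by rewrite /= inE jk orbT.
have [[p q] clus] := countably_compact_cluster _ (fun k => (u k, u k)) ccY.
have pN : nbhs (p, q) (half_close p `*` setT).
  by apply: nbhs_prod => //; exact: filterT.
have [j _ [/= pj _]] := clus _ pN 0%N.
have [k jk [/= pk _]] := clus _ pN j.+1.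
exact: cP (uL _ _ jk) (nearP _ _ _ pj pk).
Qed.

(** * The strategy of Player beta *)

Section Namioka.
Local Open Scope ring_scope.
Context {R : realType} {X Y : topologicalType} {Z : pseudoMetricType R}.
Variable f : X * Y -> Z.
Hypothesis ccYY : countably_compact [set: Y * Y].
Hypothesis f_x : forall y, continuous (fun x => f (x, y)).
Hypothesis f_y : forall x, continuous (fun y => f (x, y)).

Definition unif_close e V :=
  forall x x' y, V x -> V x' -> ball (f (x, y)) e (f (x', y)).

(** If every pair that the points of [s] do not [d]-distinguish were also not
distinguished by the points of [U], then [f] would be controlled on [U * Y] by
its values on [U * ys] for a finite net [ys], and separate continuity would
make [f] vary by less than [e] near any given point of [U]. *)
Lemma separating_pair (e d : R) (U : set X) (s : seq X) :
  0 < e -> 0 < d -> nonvoid_open U ->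
  (forall V, nonvoid_open V -> V `<=` U -> ~ unif_close e V) ->
  exists V y z, [/\ nonvoid_open V, V `<=` U,
    forall a, a \in s -> ball (f (a, y)) d (f (a, z)) &
    forall x, V x -> ~ ball (f (x, y)) (e / 8) (f (x, z))].
Proof.
move=> e0 d0 [oU [x0 Ux0]] nclose; set r := e / 8.
have r0 : 0 < r by rewrite divr_gt0.
(* The distance [3 * r] at [x] leaves [r] at the points close to [x]. *)
have [[x [y [z [Ux syz fyz]]]]|none] := pselect (exists x y z,
  [/\ U x, forall a, a \in s -> ball (f (a, y)) d (f (a, z)) &
      ~ ball (f (x, y)) (r + r + r) (f (x, z))]).
  pose N t := [set x' | ball (f (x, t)) r (f (x', t))].
  have Nx t : nbhs x (N t).
    exact: (f_x t x _ (nbhsx_ballx (f (x, t)) r r0)).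
  exists (U `&` ((N y)° `&` (N z)°)), y, z; split => //.
  - apply: nonvoid_openI => //; first by apply: openI; exact: open_interior.
    by exists x; split => //; split; exact: Nx.
  - move=> x' [_ [/interior_subset Ny /interior_subset Nz]] fx'; apply: fyz.
    apply: ball_triangle (ball_sym Nz); exact: ball_triangle Ny fx'.
have [ys ysP] : exists ys : seq Y, forall y, exists2 z, z \in ys &
    forall a, a \in s -> ball (f (a, z)) d (f (a, y)).
  apply: (@countably_compact_finite_net _ (fun p y =>
    forall a, a \in s -> ball (f (a, p)) (d / 2) (f (a, y)))) => //.
    move=> p; apply: (@near_finite X Y (nbhs p) _ [set` s]
      (fun a y => ball (f (a, p)) (d / 2) (f (a, y)))) => // a _.
    by apply: (f_y a p); apply: nbhsx_ballx; rewrite divr_gt0.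
  by move=> p y z py pz a sa; apply: ball_splitr (py a sa) (pz a sa).
pose N := [set x | forall t, t \in ys -> ball (f (x0, t)) r (f (x, t))].
have Nx0 : nbhs x0 N.
  apply: (@near_finite Y X (nbhs x0) _ [set` ys]
    (fun t x => ball (f (x0, t)) r (f (x, t)))) => // t _.
  apply: (f_x t x0); exact: nbhsx_ballx.
case: (nclose (U `&` N°)).
- by apply: nonvoid_openI => //; [exact: open_interior|exists x0].
- exact: subIsetl.
- move=> x x' y [Ux /interior_subset Nx] [Ux' /interior_subset Nx'].
  have [t tys ty] := ysP y.
  have close w : U w -> ball (f (w, t)) (r + r + r) (f (w, y)).
    move=> Uw; apply: contrapT => nb; apply: none.
    by exists w, t, y.
  (* From [(x, y)] to [(x', y)] through [(x, t)], [(x0, t)] and [(x', t)]. *)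
  have -> : e = (r + r + r) + (r + (r + (r + r + r))) by rewrite /r; lra.
  apply: ball_triangle (ball_sym (close x Ux)) _.
  apply: ball_triangle (ball_sym (Nx t tys)) _.
  exact: ball_triangle (Nx' t tys) (close x' Ux').
Qed.

Section Strategy.
Variables (e : R) (B1 : set X).
Hypothesis e0 : 0 < e.
Hypothesis B1_open : nonvoid_open B1.
Hypothesis B1_osc : forall V, nonvoid_open V -> V `<=` B1 -> ~ unif_close e V.

(** The tolerance [(size h)^-1] tends to 0 along a play, so that a cluster point
of the pairs [yz] is not distinguished at all by the points of Player alpha. *)
Definition separating (h : seq (set X * X)) (V : set X) (yz : Y * Y) :=
  (forall p, p \in h -> ball (f (p.2, yz.1)) (size h)%:R^-1 (f (p.2, yz.2))) /\
  (forall x, V x -> ~ ball (f (x, yz.1)) (e / 8) (f (x, yz.2))).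

Definition answer h : set (set X) := [set V |
  [/\ nonvoid_open V, V `<=` last setT (unzip1 h) &
      exists yz, separating h V yz]].

Definition sep_strategy h : set X :=
  if nilp h then B1 else xget set0 (answer h).

Lemma answer_sep_strategy h : ~~ nilp h ->
  nonvoid_open (last setT (unzip1 h)) -> last setT (unzip1 h) `<=` B1 ->
  answer h (sep_strategy h).
Proof.
rewrite /sep_strategy => hn noA AB; rewrite (negbTE hn).
have [||V [y [z [noV VA hyz Vyz]]]] :=
  @separating_pair e (size h)%:R^-1 (last setT (unzip1 h)) (unzip2 h) e0 _ noA.
- by rewrite invr_gt0 ltr0n lt0n.
- by move=> V noV VA; apply: B1_osc => //; exact: subset_trans VA AB.
apply: (@xgetPex _ set0 (answer h)); exists V; split => //.
exists (y, z); split => // p ph; apply: hyz; exact: map_f.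
Qed.

Lemma last_alpha_moves A (a : nat -> X) n :
  last setT (unzip1 (alpha_moves A a n.+1)) = A n.
Proof. by rewrite /alpha_moves mkseqS /unzip1 map_rcons last_rcons. Qed.

Lemma answer_moves A (a : nat -> X) n :
  (forall k, (k <= n)%N ->
     nonvoid_open (A k) /\ A k `<=` sep_strategy (alpha_moves A a k)) ->
  answer (alpha_moves A a n.+1) (sep_strategy (alpha_moves A a n.+1)).
Proof.
move=> legal.
have AB : forall k, (k <= n)%N -> A k `<=` B1 /\
    answer (alpha_moves A a k.+1) (sep_strategy (alpha_moves A a k.+1)).
  elim=> [|k IH] kn.
    have AB : A 0%N `<=` B1 by have [] := legal 0%N kn.
    split => //; apply: answer_sep_strategy; rewrite ?last_alpha_moves//.
    by have [] := legal 0%N kn.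
  have [AB [_ tA _]] := IH (ltnW kn); have [noA At] := legal _ kn.
  have AB' : A k.+1 `<=` B1.
    apply: subset_trans AB; apply: subset_trans At _.
    by rewrite last_alpha_moves in tA.
  by split => //; apply: answer_sep_strategy; rewrite ?last_alpha_moves.
by have [] := AB n (leqnn n).
Qed.

Lemma sep_strategy_winning : beta_winning sep_strategy.
Proof.
split.
  split=> // A a n /answer_moves[noV VA _]; split => //.
  by rewrite last_alpha_moves in VA.
move=> B A a play cons [x [xa xA]].
have legal k :
    nonvoid_open (A k) /\ A k `<=` sep_strategy (alpha_moves A a k).
  by have [_ noA AB _] := play k; rewrite -cons.
have /choice[yz yzP] n :
    exists yz, separating (alpha_moves A a n.+1) (B n.+1) yz.
  by rewrite cons; have [] := answer_moves A a n (fun k _ => legal k).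
have [[p q] clus] := countably_compact_cluster _ yz ccYY.
have Bx n : B n.+1 x by have [_ _ /(_ x (xA n.+1 I))] := play n.+1.
have agree i (d : R) : 0 < d -> ball (f (a i, p)) d (f (a i, q)).
  move=> d0; have d3 : 0 < d / 3 by rewrite divr_gt0.
  have pqN : nbhs (p, q) ([set y | ball (f (a i, p)) (d / 3) (f (a i, y))] `*`
                          [set z | ball (f (a i, q)) (d / 3) (f (a i, z))]).
    by apply: nbhs_prod; [apply: (f_y (a i) p)|apply: (f_y (a i) q)];
      exact: nbhsx_ballx.
  (* [i <= n] makes [a i] one of the moves that [yz n] takes into account. *)
  have [n nlarge [/= py qz]] :=
    clus _ pqN (maxn i (Num.truncn (d / 3)^-1)).
  have ain : (A i, a i) \in alpha_moves A a n.+1.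
    apply: map_f; rewrite mem_iota/= add0n ltnS.
    exact: leq_trans (leq_maxl _ _) nlarge.
  have yz_close : ball (f (a i, (yz n).1)) (d / 3) (f (a i, (yz n).2)).
    apply: le_ball ((yzP n).1 _ ain); rewrite size_mkseq.
    rewrite -[leRHS]invrK lef_pV2 ?posrE ?invr_gt0// ?ltr0n//.
    apply: le_trans (ltW (truncnS_gt _)) _; rewrite ler_nat ltnS.
    exact: leq_trans (leq_maxr _ _) nlarge.
  have -> : d = d / 3 + (d / 3 + d / 3) by lra.
  exact: ball_triangle py (ball_triangle yz_close (ball_sym qz)).
(* The values at [(x, p)] and [(x, q)] are within [3 * d], hence those at the
   points of [(x, yz n)] within [5 * d] for suitable [n]; this is [e / 8]. *)
pose d := e / 40; have d0 : 0 < d by rewrite divr_gt0.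
have xpq : ball (f (x, p)) (d + (d + d)) (f (x, q)).
  have [] := xa ([set w | ball (f (x, p)) d (f (w, p))] `&`
                 [set w | ball (f (x, q)) d (f (w, q))]).
    by apply: filterI; [apply: (f_x p x)|apply: (f_x q x)]; exact: nbhsx_ballx.
  move=> _ [[i _ <-] [/= xp xq]].
  exact: ball_triangle xp (ball_triangle (agree i d d0) (ball_sym xq)).
have pqN : nbhs (p, q) ([set y | ball (f (x, p)) d (f (x, y))] `*`
                        [set z | ball (f (x, q)) d (f (x, z))]).
  by apply: nbhs_prod; [apply: (f_y x p)|apply: (f_y x q)]; exact: nbhsx_ballx.
have [n _ [/= py qz]] := clus _ pqN 0%N.
apply: (yzP n).2 (Bx n) _.
have -> : e / 8 = d + ((d + (d + d)) + d) by rewrite /d; lra.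
exact: ball_triangle (ball_sym py) (ball_triangle xpq qz).
Qed.

End Strategy.

Lemma meager_osc (e : R) : 0 < e ->
  ~ (exists tau : seq (set X * X) -> set X,
       beta_winning tau /\ ~ meager (tau [::])) ->
  meager (~` [set x | exists2 V, nbhs x V & unif_close e V]).
Proof.
move=> e0 nwin; set G := [set x | _].
have oG : open G.
  rewrite openE => x [V xV Vclose]; apply: filterS (nbhs_interior xV) => w wV.
  by exists V.
apply: meager_closed; first exact: open_closedC.
have [ne|/nonemptyPn ->] := pselect ((~` G)° !=set0); last first.
  exact: meager_nowhere_dense nowhere_dense0.
apply: contrapT => nm; apply: nwin.
exists (sep_strategy e (~` G)°); split => //.
apply: sep_strategy_winning => //.
  by split => //; exact: open_interior.
move=> V [oV [x Vx]] VG Vclose; apply: (interior_subset (VG x Vx)).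
by exists V => //; exact: open_nbhs_nbhs.
Qed.

Lemma unif_close_continuous x y :
  (forall e, 0 < e -> exists2 V, nbhs x V & unif_close e V) ->
  {for (x, y), continuous f}.
Proof.
move=> xclose; apply/cvg_ballP => e e0.
have e2 : 0 < e / 2 by rewrite divr_gt0.
have [V xV Vclose] := xclose _ e2.
have := nbhs_prod xV (f_y x y _ (nbhsx_ballx (f (x, y)) _ e2)).
apply: filterS => -[x' y'] [/= Vx' yy'].
by apply: ball_split yy' (Vclose _ _ _ (nbhs_singleton xV) Vx').
Qed.

Lemma residual_continuity_points :
  ~ (exists tau : seq (set X * X) -> set X,
       beta_winning tau /\ ~ meager (tau [::])) ->
  exists D : set X,
    residual D /\ forall x y, D x -> {for (x, y), continuous f}.
Proof.
move=> nwin.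
pose G (n : nat) :=
  [set x : X | exists2 V, nbhs x V & unif_close (n.+1%:R^-1) V].
exists (\bigcap_n G n); split.
  rewrite /residual setC_bigcap; apply: meager_bigcup => n.
  by apply: meager_osc => //; rewrite invr_gt0 ltr0n.
move=> x y xG; apply: unif_close_continuous => e e0.
have [V xV Vclose] := xG (Num.truncn e^-1) I; exists V => // x1 x2 t V1 V2.
apply: le_ball (Vclose _ _ _ V1 V2).
by rewrite -[leRHS]invrK lef_pV2 ?posrE ?invr_gt0 ?ltr0n// ltW// truncnS_gt.
Qed.

End Namioka.

(** * Open subspaces of products of pseudo-metric spaces *)

Section Product.
Local Open Scope ring_scope.
Context {R : realType} {I : Type} {T : I -> pseudoMetricType R}.
Local Notation P := (prod_topology (fun i => T i : topologicalType)).
Implicit Types (w : P) (E : set I).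

Lemma continuous_coordinate i : continuous (fun w : P => w i : T i).
Proof. exact: (@proj_continuous {classic I}). Qed.

(** Interiors, because the relation [ball] need not have open sections. *)
Definition cylinder E (e : R) w : set P :=
  [set w' | forall i, E i -> (ball (w i) e)° (w' i)].

Lemma open_cylinder E e w : finite_set E -> open (cylinder E e w).
Proof.
move=> finE; rewrite openE => w' ww'; apply: (@near_finite I P (nbhs w') _ E
  (fun i v => (ball (w i) e)° (v i))) => // i Ei.
exact: (continuous_coordinate i w' _ (nbhs_interior (ww' i Ei))).
Qed.

Lemma nbhs_cylinder w V : nbhs w V ->
  exists E e, [/\ finite_set E, 0 < e & cylinder E e w `<=` V].
Proof.
(* The sets that contain a cylinder form a filter that converges to [w] in
   every coordinate, hence in the product. *)
pose F : set_system P := [set V | exists E (e : R),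
  [/\ finite_set E, 0 < e & cylinder E e w `<=` V]].
have FF : Filter F.
  split.
  - by exists set0, 1; split => //; exact: ltr01.
  - move=> V1 V2 [E1 [e1 [fE1 e10 s1]]] [E2 [e2 [fE2 e20 s2]]].
    exists (E1 `|` E2), (Num.min e1 e2); split.
    + by rewrite finite_setU.
    + by rewrite lt_min e10.
    + move=> w' ww'; split; [apply: s1|apply: s2] => i Ei.
        apply: interiorS (ww' i (or_introl Ei)); apply: le_ball.
        by rewrite ge_min lexx.
      apply: interiorS (ww' i (or_intror Ei)); apply: le_ball.
      by rewrite ge_min lexx orbT.
  - move=> V1 V2 s12 [E [e [fE e0 s1]]]; exists E, e; split => //.
    exact: subset_trans s12.
suff : nbhs F `=>` nbhs w by apply.
apply/cvg_sup => i A [_ [[C oC <-] Cw CA]].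
have /nbhs_ballP[e e0 eC] : nbhs (w i) C by exact: open_nbhs_nbhs.
exists [set i], e; split => //.
move=> w' ww'; apply: CA; apply: eC; exact: interior_subset (ww' i erefl).
Qed.

Section Game.
Context {X : topologicalType} (phi : X -> P) (tau : seq (set X * X) -> set X).
Hypothesis phi_cont : continuous phi.
Hypothesis phi_inj : injective phi.
Hypothesis phi_open : forall V, open V -> open (phi @` V).
Hypothesis tau_strategy : beta_strategy tau.
Variable x0 : X.
Let b := phi x0.

Let dflt := ([set: X], x0).

Definition legal (h : seq (set X * X)) := forall k, (k < size h)%N ->
  nonvoid_open (nth dflt h k).1 /\ (nth dflt h k).1 `<=` tau (take k h).

Lemma legal_rcons h A a : legal h -> nonvoid_open A -> A `<=` tau h ->
  legal (rcons h (A, a)).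
Proof.
move=> lh noA Ah k; rewrite size_rcons ltnS leq_eqVlt nth_rcons.
move=> /predU1P[->|kh].
  by rewrite ltnn eqxx -cats1 take_size_cat.
by rewrite kh -cats1 takel_cat ?(ltnW kh)//; exact: lh.
Qed.

Lemma legal_reply h A a : legal (rcons h (A, a)) ->
  nonvoid_open (tau (rcons h (A, a))) /\ tau (rcons h (A, a)) `<=` A.
Proof.
set g := rcons h (A, a) => lg; have [_ reply] := tau_strategy.
pose A' k := (nth dflt g k).1; pose a' k := (nth dflt g k).2.
have moves k : (k <= size g)%N -> alpha_moves A' a' k = take k g.
  move=> kg; apply: (@eq_from_nth _ dflt).
    by rewrite size_mkseq size_takel.
  move=> j; rewrite size_mkseq => jk.
  by rewrite nth_mkseq// nth_take// /A' /a'; case: nth.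
have sg : size g = (size h).+1 by rewrite size_rcons.
have -> : A = A' (size h) by rewrite /A' nth_rcons ltnn eqxx.
have gE : g = alpha_moves A' a' (size h).+1 by rewrite moves -sg// take_size.
rewrite [X in tau X]gE; apply: reply => k kh.
by rewrite moves ?sg ?leqW//; apply: lg; rewrite sg ltnS.
Qed.

Lemma legal_tau h : legal h -> nonvoid_open (tau h).
Proof.
case/lastP: h => [|h [A a] lh]; first by move=> _; have [] := tau_strategy.
by have [] := legal_reply _ _ _ lh.
Qed.

(** The last condition allows points of [A] to be changed outside [E].  It asks
for the whole fibre in the product, because [phi] reaches only a part of it. *)
Definition box_move n E (A : set X) a :=
  [/\ nonvoid_open A /\ A a,
     forall i, ~ E i -> phi a i = b i,
     forall x y, A x -> A y ->
       forall i, E i -> ball (phi x i) n.+1%:R^-1 (phi y i) &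
     forall x w, A x -> (forall i, E i -> w i = phi x i) ->
       exists2 u, A u & phi u = w].

Lemma box_move_ex n E V : finite_set E -> nonvoid_open V ->
  exists E' A a, [/\ finite_set E', E `<=` E', A `<=` V & box_move n E' A a].
Proof.
move=> fE [oV [x Vx]].
have : nbhs (phi x) (phi @` V).
  by apply: open_nbhs_nbhs; split; [exact: phi_open|exists x].
move=> /nbhs_cylinder[E0 [e [fE0 e0 cylV]]].
pose r := Num.min e (n.+1%:R^-1 / 2).
have r0 : 0 < r by rewrite lt_min e0 divr_gt0// invr_gt0.
pose E' := E `|` E0; pose C := cylinder E' r (phi x).
have fE' : finite_set E' by rewrite finite_setU.
have CV : C `<=` phi @` V.
  move=> w Cw; apply: cylV => i Ei.
  apply: interiorS (Cw i (or_intror Ei)); apply: le_ball.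
  by rewrite ge_min lexx.
have ctr i : (ball (phi x i) r)° (phi x i) by exact: nbhsx_ballx.
pose w i : T i := if pselect (E' i) then phi x i else b i.
have Cw : C w by move=> i Ei; rewrite /w; case: pselect.
have [a Va aw] := CV w Cw.
exists E', (phi @^-1` C), a; split => //.
- exact: subsetUl.
- by move=> y /= /CV[v Vv /phi_inj <-].
split.
- split; last by rewrite /= aw.
  split; last by exists a; rewrite /= aw.
  by apply: open_comp => [y _|]; [exact: phi_cont|exact: open_cylinder].
- by move=> i nEi; rewrite aw /w; case: pselect.
- move=> y z Cy Cz i Ei.
  apply: (@ball_splitr _ _ (phi x i)).
    have := interior_subset (Cy i Ei); apply: le_ball.
    by rewrite ge_min lexx orbT.
  have := interior_subset (Cz i Ei); apply: le_ball.
  by rewrite ge_min lexx orbT.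
- move=> y v Cy vy; have Cv : C v by move=> i Ei; rewrite vy//; exact: Cy.
  by have [u Vu uv] := CV v Cv; exists u => //; rewrite /= uv.
Qed.

(* A history of Player alpha, and the coordinates used so far. *)
Let S := (seq (set X * X) * set I)%type.
Definition legal_state (s : S) := legal s.1 /\ finite_set s.2.
Definition box_step (s t : S) := exists A a,
  [/\ t.1 = rcons s.1 (A, a), s.2 `<=` t.2, finite_set t.2,
      A `<=` tau s.1 & box_move (size s.1) t.2 A a].

Lemma legal_box_step s t : legal_state s -> box_step s t ->
  legal_state t /\ tau t.1 `<=` tau s.1.
Proof.
move=> [ls fs] [A [a [tE _ ft As [[noA _] _ _ _]]]].
have lgt : legal t.1 by rewrite tE; exact: legal_rcons.
split=> //; rewrite tE in lgt *.
by apply: subset_trans As; have [] := legal_reply _ _ _ lgt.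
Qed.

Lemma box_step_ex s V : legal_state s -> nonvoid_open V -> V `<=` tau s.1 ->
  exists t, [/\ box_step s t, tau t.1 `<=` V & tau t.1 !=set0].
Proof.
move=> [ls fs] noV Vs.
have [E [A [a [fE sE AV mv]]]] := box_move_ex (size s.1) _ _ fs noV.
have noA : nonvoid_open A by case: mv => -[].
have As := subset_trans AV Vs.
have [[_ ne] tA] := legal_reply _ _ _ (legal_rcons _ _ a ls noA As).
exists (rcons s.1 (A, a), E); split => //; first by exists A, a.
exact: subset_trans AV.
Qed.

(** Player alpha keeps to the moves [box_move] along a branch whose open sets
have a common point [x].  The point [w] equal to [x] on the coordinates used and
to [b] elsewhere belongs to all the cylinders, and [a n] is close to [w] on the
coordinates used up to step [n] and equal to it on those never used. *)
Lemma alpha_beats : ~ meager (tau [::]) ->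
  exists B A a, [/\ Jp_play B A a, consistent tau B A a & alpha_wins A a].
Proof.
move=> nm; pose s0 : S := ([::], set0).
have ok0 : legal_state s0 by split.
have [] := @nonmeager_branch X S (fun s => tau s.1) box_step legal_state s0 ok0.
- by move=> s [ls _]; have [] := legal_tau _ ls.
- exact: legal_box_step.
- exact: box_step_ex.
- exact: nm.
move=> s [x [s_0 s_next s_x]].
have s_ok n : legal_state (s n).
  elim: n => [|n okn]; first by rewrite s_0.
  by have [] := legal_box_step _ _ okn (s_next n).
have /choice[Aa AaP] n : exists Aa : set X * X,
    [/\ (s n.+1).1 = rcons (s n).1 Aa, (s n).2 `<=` (s n.+1).2,
        Aa.1 `<=` tau (s n).1 &
        box_move (size (s n).1) (s n.+1).2 Aa.1 Aa.2].
  by have [A [a [sE s2 _ As mv]]] := s_next n; exists (A, a).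
pose A n := (Aa n).1; pose a n := (Aa n).2; pose E n := (s n.+1).2.
have movesE n : (s n).1 = alpha_moves A a n.
  elim: n => [|n IH]; first by rewrite s_0.
  have [-> _ _ _] := AaP n.
  by rewrite /alpha_moves mkseqS IH /A /a; case: (Aa n).
have mv n : box_move n (E n) (A n) (a n).
  by have [_ _ _] := AaP n; rewrite movesE size_mkseq.
have tauA n : tau (s n.+1).1 `<=` A n.
  have [sE _ _ _] := AaP n; have [] := s_ok n.+1; rewrite sE => + _.
  by rewrite /A; case: (Aa n) => A' a' /legal_reply[].
have Ax n : A n x by exact: tauA.
have E_mono m n : (m <= n)%N -> E m `<=` E n.
  elim: n => [|n IH]; first by rewrite leqn0 => /eqP ->.
  rewrite leq_eqVlt => /predU1P[->//|/IH mn]; apply: subset_trans mn _.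
  by have [_ ] := AaP n.+1.
pose F := \bigcup_n E n.
pose w : P := fun i => if pselect (F i) then phi x i else b i.
have wF i : F i -> w i = phi x i by rewrite /w; case: pselect.
have wNF i : ~ F i -> w i = b i by rewrite /w; case: pselect.
have lift n : exists2 u, A n u & phi u = w.
  have [_ _ _ cyl] := mv n; apply: (cyl x) => // i Ei; apply: wF.
  by exists n.
(* Injectivity of [phi] makes the lifts of [w] to the sets [A n] coincide. *)
have [u _ uw] := lift 0%N.
have Au n : A n u by have [v Av vw] := lift n; rewrite (phi_inj u v)// uw.
exists (fun n => tau (s n).1), A, a; split.
- move=> n; split.
  + by apply: legal_tau; have [] := s_ok n.
  + by have [[]] := mv n.
  + by have [] := AaP n.
  + exact: tauA.
- by move=> n; rewrite movesE.
exists u; split; last by move=> n _.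
move=> N; rewrite nbhsE => -[V [oV Vu] VN].
have : nbhs w (phi @` V).
  by apply: open_nbhs_nbhs; split; [exact: phi_open|exists u].
move=> /nbhs_cylinder[E0 [e [fE0 e0 cylV]]].
have [m _ mE] : \forall n \near \oo, forall i, E0 i -> F i -> E n i.
  apply: near_finite => // i _.
  have [[k _ Ek]|nF] := pselect (F i); last by apply: nearW.
  by exists k => // n /= kn _; exact: E_mono Ek.
pose n := maxn m (Num.truncn (e / 2)^-1).
have [[_ An] aE small _] := mv n.
exists (a n); split; first by exists n.
apply: VN; suff [v Vv /phi_inj <-] : (phi @` V) (phi (a n)) by [].
apply: cylV => i Ei.
have [Fi|nFi] := pselect (F i); last first.
  rewrite wNF// aE; first by exact: nbhsx_ballx.
  by move=> En; apply: nFi; exists n.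
have en : n.+1%:R^-1 <= e / 2.
  rewrite -[leRHS]invrK lef_pV2 ?posrE ?invr_gt0 ?divr_gt0 ?ltr0n//.
  apply: le_trans (ltW (truncnS_gt _)) _; rewrite ler_nat ltnS.
  exact: leq_maxr.
have wa : ball (w i) (e / 2) (phi (a n) i).
  rewrite -uw; apply: le_ball en _ _; apply: small => //.
  exact: (mE n (leq_maxl _ _)).
apply/nbhs_ballP; exists (e / 2); first by rewrite /= divr_gt0.
by move=> z; exact: ball_split wa.
Qed.

End Game.
End Product.

Section Subspace.
Context {W V : topologicalType} {U : set W} (f : W -> V) (g : V -> W).
Hypotheses (f_cont : continuous f) (g_cont : continuous g).
Hypotheses (fK : cancel f g) (gK : cancel g f).

Lemma embed_continuous : continuous (f \o set_val : set_type U -> V).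
Proof.
move=> u; apply: continuous_comp; last exact: f_cont.
exact: (@initial_continuous (set_type U) W set_val).
Qed.

Lemma embed_injective : injective (f \o set_val : set_type U -> V).
Proof. by move=> u v /= /(can_inj fK); exact: val_inj. Qed.

Lemma embed_open (O : set (set_type U)) : open U -> open O ->
  open ((f \o set_val) @` O).
Proof.
move=> oU [O' oO' <-].
rewrite (_ : _ @` _ = g @^-1` (O' `&` U)).
  by apply: open_comp => [v _|]; [exact: g_cont|exact: openI].
apply/seteqP; split=> [_ [u O'u <-]|v [O'v Uv]] /=.
  by rewrite fK; split => //; exact: set_valP.
exists (exist _ (g v) (mem_set Uv)) => //=; exact: gK.
Qed.

End Subspace.

Theorem theorem3p4 (R : realType) :
  (forall (X Y : topologicalType) (Z : pseudoMetricType R) (f : X * Y -> Z),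
     ~ (exists tau : seq (set X * X) -> set X,
          beta_winning tau /\ ~ meager (tau [::])) ->
     countably_compact [set: Y * Y] ->
     separately_continuous f ->
     exists D : set X, residual D /\
       forall x y, D x -> {for (x, y), continuous f})
  /\
  (forall (W : topologicalType) (U : set W) (Y : topologicalType)
     (Z : pseudoMetricType R) (f : set_type U * Y -> Z),
     Pi_pseudo_metric R W -> open U ->
     countably_compact [set: Y * Y] ->
     separately_continuous f ->
     exists D : set (set_type U), residual D /\
       forall x y, D x -> {for (x, y), continuous f}).
Proof.
split=> [X Y Z f nwin ccYY [f_x f_y]|].
  exact: residual_continuity_points.
move=> W U Y Z f [I [T [h [k [hc kc hK kK]]]]] oU ccYY [f_x f_y].
apply: residual_continuity_points => // -[tau [[tau_strat tau_win] nm]].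
have [[_ [x0 _]] _] := tau_strat.
have [|||B [A [a [play cons win]]]] :=
  alpha_beats (h \o set_val) tau _ _ _ tau_strat x0 nm.
- exact: embed_continuous.
- exact: embed_injective hK.
- by move=> V oV; exact: (embed_open _ _ kc hK kK).
- exact: tau_win play cons win.
Qed.
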